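(* Let $W$ be the right-angled Coxeter group of a finite simplicial graph $\Gamma$ with vertices $v_1,\dots,v_N$, and suppose the following conditions are satisfied: (1) $\Gamma\setminus S_i\ne\emptyset$ for each $1\le i\le N$; (2) $f(\Delta_i)=\Delta_i$ for each (labeled-)graph isomorphism $f:\Gamma\to\Gamma$ and each $1\le i\le N$, where $\Delta_i=\{v_j: S_i=S_j\}$; (3) $S_i\subseteq S_j$ if and only if $S_i=S_j$, for each $1\le i,j\le N$. Then all group extensions $1\to W\to E\to G\to1$ are trivial, that is, they are split extensions.
   Context: The right-angled Coxeter group $W$ of $\Gamma$ is the group with generators the vertices $V=\{v_1,\dots,v_N\}$ ($N\ge1$) and relations $v_i^2=1$ for all $i$ and $v_jv_k=v_kv_j$ whenever $v_j,v_k$ are adjacent in $\Gamma$ (all labels equal $2$, so labeled-graph isomorphisms of $\Gamma$ are just graph automorphisms). $S_i$ is the star of $v_i$ (the full subgraph on the vertices at distance at most $1$ from $v_i$). *)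

(* Defs.v *)
From HB Require Import structures.
From mathcomp Require Import all_boot boolp.

Set Implicit Arguments.
Unset Strict Implicit.
Unset Printing Implicit Defensive.

Local Open Scope quotient_scope.
Local Open Scope group_scope.

Section Presentation.
Variable X : choiceType.

(* The letter (x, false) is the generator x, and (x, true) is its formal
   inverse. *)
Definition word := seq (X * bool).

Definition letter (x : X) : X * bool := (x, false).

Variable R : word -> word -> Prop.

(* The least congruence on words which contains R and for which (x, b) and
   (x, ~~ b) are mutually inverse. *)
Inductive word_eq : word -> word -> Prop :=
| word_eq_refl u : word_eq u u
| word_eq_sym u v : word_eq u v -> word_eq v u
| word_eq_trans v u w : word_eq u v -> word_eq v w -> word_eq u w
| word_eq_cat u u' v v' :
    word_eq u u' -> word_eq v v' -> word_eq (u ++ v) (u' ++ v')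
| word_eq_cancel x b : word_eq [:: (x, b); (x, ~~ b)] [::]
| word_eq_rel u v : R u v -> word_eq u v.

Definition word_eqb : rel word := fun u v => `[< word_eq u v >].

Lemma word_eqb_refl : reflexive word_eqb.
Proof. by move=> u; apply/asboolP/word_eq_refl. Qed.

Lemma word_eqb_sym : symmetric word_eqb.
Proof. by move=> u v; apply/asboolP/asboolP => /word_eq_sym. Qed.

Lemma word_eqb_trans : transitive word_eqb.
Proof.
move=> v u w /asboolP uv /asboolP vw; apply/asboolP.
exact: word_eq_trans uv vw.
Qed.

Canonical word_equiv := EquivRel word_eqb word_eqb_refl word_eqb_sym word_eqb_trans.

Definition presented := {eq_quot word_equiv}.
HB.instance Definition _ := Choice.on presented.
HB.instance Definition _ := Quotient.on presented.

Lemma presented_eqP (u v : word) :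
  \pi_presented u = \pi_presented v <-> word_eq u v.
Proof.
split=> [/eqmodP/asboolP // | uv].
by apply/eqmodP/asboolP.
Qed.

Lemma presentedP (a : presented) : exists u, a = \pi_presented u.
Proof. by exists (repr a); rewrite reprK. Qed.

Definition word_inv (u : word) : word := rev [seq (a.1, ~~ a.2) | a <- u].

Lemma word_invV u : word_eq (word_inv u ++ u) [::].
Proof.
elim: u => [|[x b] u IH]; first exact: word_eq_refl.
rewrite /word_inv /= rev_cons cat_rcons.
apply: word_eq_trans IH; apply: word_eq_cat; first exact: word_eq_refl.
rewrite -[X in word_eq _ X]cat0s -[X in word_eq X _]/([:: _; _] ++ u).
apply: word_eq_cat; last exact: word_eq_refl.
by rewrite -{2}[b]negbK; exact: word_eq_cancel.
Qed.

Lemma word_invK : involutive word_inv.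
Proof.
move=> u; rewrite /word_inv map_rev revK -map_comp -[RHS]map_id.
by apply: eq_map => -[x b] /=; rewrite negbK.
Qed.

Lemma word_inv_cat u v : word_inv (u ++ v) = word_inv v ++ word_inv u.
Proof. by rewrite /word_inv map_cat rev_cat. Qed.

Lemma word_inv_eq u v : word_eq u v -> word_eq (word_inv u) (word_inv v).
Proof.
move=> uv; have vV : word_eq (v ++ word_inv v) [::].
  by rewrite -{1}[v]word_invK; exact: word_invV.
apply: (@word_eq_trans (word_inv u ++ (v ++ word_inv v))).
  apply: word_eq_sym; rewrite -[X in word_eq _ X]cats0.
  by apply: word_eq_cat => //; exact: word_eq_refl.
rewrite catA -[X in word_eq _ X]cat0s.
apply: word_eq_cat; last exact: word_eq_refl.
apply: word_eq_trans (word_invV u).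
by apply: word_eq_cat; [exact: word_eq_refl | exact: word_eq_sym].
Qed.

Definition presented_one : presented := \pi_presented [::].
Definition presented_mul (a b : presented) : presented :=
  \pi_presented (repr a ++ repr b).
Definition presented_inv (a : presented) : presented :=
  \pi_presented (word_inv (repr a)).

Lemma word_eq_repr u : word_eq (repr (\pi_presented u)) u.
Proof. by apply/presented_eqP; exact: reprK. Qed.

Lemma presented_mulE u v :
  presented_mul (\pi_presented u) (\pi_presented v) = \pi_presented (u ++ v).
Proof. by apply/presented_eqP/word_eq_cat; exact: word_eq_repr. Qed.

Lemma presented_invE u :
  presented_inv (\pi_presented u) = \pi_presented (word_inv u).
Proof. by apply/presented_eqP/word_inv_eq; exact: word_eq_repr. Qed.

Lemma presented_mulA : associative presented_mul.
Proof.
move=> a b c; have [u ->] := presentedP a; have [v ->] := presentedP b.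
have [w ->] := presentedP c.
by rewrite (presented_mulE v w) (presented_mulE u v) !presented_mulE catA.
Qed.

Lemma presented_mul1 : left_id presented_one presented_mul.
Proof. by move=> a; have [u ->] := presentedP a; exact: presented_mulE. Qed.

Lemma presented_mulr1 : right_id presented_one presented_mul.
Proof.
move=> a; have [u ->] := presentedP a.
by rewrite -[in RHS](cats0 u); exact: presented_mulE.
Qed.

Lemma presented_mulV : left_inverse presented_one presented_inv presented_mul.
Proof.
move=> a; have [u ->] := presentedP a; rewrite presented_invE presented_mulE.
exact/presented_eqP/word_invV.
Qed.

Lemma presented_mulrV : right_inverse presented_one presented_inv presented_mul.
Proof.
move=> a; have [u ->] := presentedP a; rewrite presented_invE presented_mulE.
by apply/presented_eqP; rewrite -{1}[u]word_invK; exact: word_invV.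
Qed.

HB.instance Definition _ := isGroup.Build presented presented_mulA
  presented_mul1 presented_mulr1 presented_mulV presented_mulrV.

Definition generator (x : X) : presented := \pi_presented [:: letter x].

Definition word_eval (H : groupType) (f : X -> H) (u : word) : H :=
  foldr (fun a h => (if a.2 then (f a.1)^-1 else f a.1) * h) 1 u.

Lemma word_eval_cat (H : groupType) (f : X -> H) u v :
  word_eval f (u ++ v) = word_eval f u * word_eval f v.
Proof. by elim: u => [|a u IH] /=; rewrite ?mul1g // IH mulgA. Qed.

Lemma presented_lift (H : groupType) (f : X -> H) :
  (forall u v, R u v -> word_eval f u = word_eval f v) ->
  exists2 phi : {multiplicative presented -> H},
    forall x, phi (generator x) = f x &
    forall psi : {multiplicative presented -> H},
      (forall x, psi (generator x) = f x) -> psi =1 phi.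
Proof.
move=> fR; have f_eq u v : word_eq u v -> word_eval f u = word_eval f v.
  elim=> {u v} // [u v w _ -> //|u u' v v' _ Eu _ Ev|x [|]] /=.
  - by rewrite !word_eval_cat Eu Ev.
  - by rewrite mulg1 mulVg.
  - by rewrite mulg1 mulgV.
pose phi (a : presented) := word_eval f (repr a).
have phiE u : phi (\pi_presented u) = word_eval f u.
  exact/f_eq/word_eq_repr.
have phiM : {morph phi : a b / a * b}.
  by move=> a b; rewrite phiE word_eval_cat.
pose phi_mix := isMultiplicative.Build presented H phi phiM.
pose phi_hom : {multiplicative presented -> H} := HB.pack phi phi_mix.
exists phi_hom => [x|psi psiE a]; first by rewrite [LHS]phiE /= mulg1.
have [u ->] := presentedP a; rewrite [RHS]phiE.
have psi1 : psi 1 = 1.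
  by apply: (mulgI (psi 1)); rewrite -gmulfM !mulg1.
have psiV b : psi b^-1 = (psi b)^-1.
  by apply: (mulgI (psi b)); rewrite -gmulfM !mulgV.
elim: u => [|[x b] u IH]; first exact: psi1.
rewrite -[_ :: u]cat1s word_eval_cat -IH -presented_mulE.
transitivity (psi (\pi_presented [:: (x, b)]) * psi (\pi_presented u)).
  exact: gmulfM.
congr (_ * _); rewrite /= mulg1; case: b => /=; last exact: psiE.
rewrite -psiE -psiV; congr (psi _); symmetry; exact: presented_invE.
Qed.

End Presentation.

Section Graph.
Variables (N : nat) (e : rel 'I_N).

(* A full subgraph is represented by its set of vertices. *)
Definition star (i : 'I_N) : {set 'I_N} := [set j | (j == i) || e i j].

Definition star_class (i : 'I_N) : {set 'I_N} := [set j | star i == star j].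

Definition graph_automorphism (f : 'I_N -> 'I_N) : Prop :=
  bijective f /\ forall i j, e (f i) (f j) = e i j.

Inductive racg_rel : word 'I_N -> word 'I_N -> Prop :=
| racg_square i : racg_rel [:: letter i; letter i] [::]
| racg_commute i j :
    e i j -> racg_rel [:: letter i; letter j] [:: letter j; letter i].

Definition racg : groupType := presented racg_rel.

End Graph.

Record group_extension (W E G : groupType)
    (iota : {multiplicative W -> E}) (p : {multiplicative E -> G}) : Prop := {
  extension_inj : injective iota;
  extension_exact : forall x : E, p x = 1 <-> exists w : W, iota w = x;
  extension_surj : forall g : G, exists x : E, p x = g
}.

Definition split_extension (E G : groupType) (p : {multiplicative E -> G}) : Prop :=
  exists s : {multiplicative G -> E}, cancel s p.

(* Main.v *)
From HB Require Import structures.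
Require Import Defs.
From mathcomp Require Import all_boot boolp.

(* Write v_i for the generators, Delta_i for the class of vertices with the same
   star as i, and W_T for the subgroup generated by a set T of vertices.
   Every involution of W is conjugate to the product of a clique C, and the
   centralizer of that product is generated by the common star of C. By (3) the
   centre of the centralizer of v_i is W_(Delta_i), so every automorphism
   permutes the conjugacy classes of the subgroups W_(Delta_i); the permutation
   preserves adjacency and sizes, hence comes from a graph automorphism and is
   trivial by (2). Likewise, for a maximal clique M, an automorphism composed
   with a suitable inner one preserves W_(Delta_i) for all i in M at once.
   Now E acts on W by conjugation. By (1) choose for each i a vertex far i that
   is not in the star of i. The elements x of E which preserve W_(Delta_i) for
   i in M, and which send W_(Delta_(far i)) to a conjugate by some g whose
   letters in Delta_i all have even multiplicity, form a complement of W in E: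
   an element of W of this kind lies in W_M and has only even multiplicities,
   and an arbitrary x can be corrected first by an element of W and then by an
   element of W_M. *)

(** * Group morphisms and conjugation *)

Section GroupMorphisms.

Local Open Scope group_scope.
Set Implicit Arguments.
Unset Strict Implicit.
Unset Printing Implicit Defensive.

Variables (G H : groupType) (f : {multiplicative G -> H}).

Lemma group_hom1 : f 1 = 1.
Proof. by apply: (mulgI (f 1)); rewrite -gmulfM !mulg1. Qed.

Lemma group_homV : {morph f : x / x^-1}.
Proof.
by move=> x; apply: (mulgI (f x)); rewrite -gmulfM !mulgV group_hom1.
Qed.

Lemma group_homJ : {morph f : x y / x ^ y}.
Proof. by move=> x y; rewrite !conjgE !gmulfM group_homV. Qed.

Lemma commuteJ (x y g : G) : commute x y -> commute (x ^ g) (y ^ g).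
Proof. by rewrite /commute -!conjMg => ->. Qed.

End GroupMorphisms.

Section RightAngledCoxeter.

Local Open Scope group_scope.
Set Implicit Arguments.
Unset Strict Implicit.
Unset Printing Implicit Defensive.

Variables (N : nat) (e : rel 'I_N).
Hypotheses (e_irr : irreflexive e) (e_sym : symmetric e).

Local Notation V := 'I_N.
Implicit Types (i j k l c s t : V) (u v w : seq V).

(** * Normal forms *)

(* Removes an occurrence of s that can be shuffled to the front of w. *)
Fixpoint extract s w : option (seq V) :=
  if w is t :: w' then
    if t == s then Some w' else if e s t then omap (cons t) (extract s w') else None
  else None.

(** Left multiplication by the generator s on normal forms: s cancels against an occurrence that can
    be shuffled to the front, and is prepended otherwise. *)
Definition act s w := if extract s w is Some w' then w' else s :: w.

Fixpoint reduced w :=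
  if w is s :: w' then (extract s w' == None) && reduced w' else true.

Definition proj x y w := filter (pred2 x y) w.

(* Cartier-Foata: these are exactly the words that differ by exchanges of
   adjacent commuting letters. *)
Definition trace_eq u v := forall x y, ~~ e x y -> proj x y u = proj x y v.

Lemma edge_neq s t : e s t -> s != t.
Proof. by apply: contraTneq => ->; rewrite e_irr. Qed.

Lemma extract_perm s w w' : extract s w = Some w' -> perm_eq w (s :: w').
Proof.
elim: w w' => [|t w IH] //= w'; case: eqP => [-> [->] //|_].
case: ifP => // _; case: (extract s w) IH => //= w1 /(_ _ erefl) pw [<-].
rewrite -(perm_cons t) in pw; apply: perm_trans pw _.
exact: (permEl (perm_catCA [:: t] [:: s] w1)).
Qed.

Lemma extract_size s w w' : extract s w = Some w' -> size w = (size w').+1.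
Proof. by move=> /extract_perm/perm_size. Qed.

Lemma extract_proj s w w' x y : extract s w = Some w' -> ~~ e x y ->
  proj x y w = if (s == x) || (s == y) then s :: proj x y w' else proj x y w'.
Proof.
move=> + nxy; rewrite /proj; elim: w w' => [|t w IH] //= w'.
case: eqP => [-> [->] //|/eqP ts]; case: ifP => // est.
case: (extract s w) IH => //= w1 /(_ _ erefl) -> [<-] /=.
case: (eqVneq s x) => [?|sx] /=.
  subst; rewrite (negPf ts) /=.
  by case: eqP => // ty; move: nxy; rewrite -ty est.
case: (eqVneq s y) => [?|//] /=.
subst; rewrite (negPf ts) orbF.
by case: eqP => // tx; move: nxy; rewrite e_sym -tx est.
Qed.

(** The witness is the first letter that blocks s, or s itself if all of w is adjacent to s. With
    [extract_proj], whether s can be extracted is thus visible in the projections. *)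
Lemma extract_None s w : extract s w = None ->
  exists2 y, ~~ e s y & ohead (proj s y w) != Some s.
Proof.
rewrite /proj; elim: w => [|t w IH] /=; first by exists s; rewrite // e_irr.
case: eqP => // /eqP ts; case: ifP => [est|/negbT nst _].
  case: (extract s w) IH => //= /(_ erefl)[y nsy hy] _; exists y => //=.
  by case: (t =P y) => // ty; move: nsy; rewrite -ty est.
exists t => //=; rewrite eqxx ?orbT /=; by apply: contra ts => /eqP[->].
Qed.

Lemma extract_trace_eq s u v u' : trace_eq u v -> extract s u = Some u' ->
  exists2 v', extract s v = Some v' & trace_eq u' v'.
Proof.
move=> uv du; case dv: (extract s v) => [v'|]; last first.
  have [y nsy] := extract_None dv; rewrite -uv // (extract_proj du nsy).
  by rewrite eqxx /= eqxx.
exists v' => // x y nxy; have := uv x y nxy.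
by rewrite (extract_proj du nxy) (extract_proj dv nxy); case: ifP => // _ [].
Qed.

Lemma trace_eq_sym u v : trace_eq u v -> trace_eq v u.
Proof. by move=> uv x y /uv. Qed.

Lemma trace_eq_trans v u w : trace_eq u v -> trace_eq v w -> trace_eq u w.
Proof. by move=> uv vw x y nxy; rewrite uv // vw. Qed.

Lemma trace_eq_perm u v : trace_eq u v -> perm_eq u v.
Proof.
move=> uv; rewrite /perm_eq; apply/allP => s _; apply/eqP.
(* The pair (s, s) counts as non-commuting, and its projection records the multiplicity of s. *)
have := congr1 size (uv s s (negbT (e_irr s))); rewrite !size_filter.
by under eq_count do rewrite /= orbb; under [RHS]eq_count do rewrite /= orbb.
Qed.

Lemma act_trace_eq s u v : trace_eq u v -> trace_eq (act s u) (act s v).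
Proof.
move=> uv; rewrite /act; case du: (extract s u) => [u'|].
  by have [v' -> ] := extract_trace_eq uv du.
case dv: (extract s v) => [v'|].
  by have [u'] := extract_trace_eq (trace_eq_sym uv) dv; rewrite du.
by move=> x y /uv; rewrite /proj /= => ->.
Qed.

Lemma extract_comm s t w : e s t ->
  obind (extract s) (extract t w) = obind (extract t) (extract s w).
Proof.
move=> est; have st := edge_neq est; have ets : e t s by rewrite e_sym.
elim: w => [|r w IH] //=; case: (eqVneq r t) => [->|rt] /=.
  by rewrite eq_sym (negPf st) est; case: (extract s w) => //= ?; rewrite eqxx.
case: (eqVneq r s) => [->|rs] /=.
  by rewrite ets; case: (extract t w) => //= ?; rewrite eqxx.
have [etr|ntr] := boolP (e t r); have [esr|nsr] := boolP (e s r) => /=.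
- move: IH; case: (extract s w) => [ws|]; case: (extract t w) => [wt|] //=.
  + by rewrite (negPf rs) (negPf rt) esr etr => ->.
  + by rewrite (negPf rt) etr => <-.
  + by rewrite (negPf rs) esr => ->.
- by case: (extract t w) => //= ?; rewrite (negPf rs) (negPf nsr).
- by case: (extract s w) => //= ?; rewrite (negPf rt) (negPf ntr).
- by [].
Qed.

Lemma extract_extract s t w ws wt : s != t ->
  extract s w = Some ws -> extract t w = Some wt -> extract s wt != None.
Proof.
move=> st; elim: w ws wt => [|r w IH] //= ws wt.
case: (eqVneq r s) => [rs|rs].
  rewrite rs (negPf st) => _; case: ifP => // _.
  by case: (extract t w) => //= w1 [<-] /=; rewrite eqxx.
case: (eqVneq r t) => [-> |rt].
  by case: ifP => // _; case ds: (extract s w) => //= _ [<-]; rewrite ds.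
case: ifP => // esr; case: ifP => // etr.
case: (extract s w) IH => //= w1; case: (extract t w) => //= w2 /(_ _ _ erefl erefl).
by move=> + _ [<-] /=; rewrite (negPf rs) esr; case: (extract s w2).
Qed.

Lemma reduced_extract s w w' : reduced w -> extract s w = Some w' ->
  reduced w' /\ extract s w' = None.
Proof.
elim: w w' => [|t w IH] //= w' /andP[/eqP dt rw].
case: (eqVneq t s) => [<- [<-] //|ts]; case: ifP => // est.
case ds: (extract s w) => [w1|] //= -[<-] /=; rewrite (negPf ts) est.
have [r1 ->] := IH _ rw ds; rewrite r1 andbT; split=> //.
by have := extract_comm w est; rewrite ds dt /= => <-.
Qed.

Lemma reduced_act s w : reduced w -> reduced (act s w).
Proof.
rewrite /act => rw; case ds: (extract s w) => [w'|]; first by case: (reduced_extract rw ds).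
by rewrite /= ds rw.
Qed.

Lemma act_act s w : reduced w -> trace_eq (act s (act s w)) w.
Proof.
rewrite /act => rw; case ds: (extract s w) => [w'|]; last by rewrite /= eqxx.
have [_ ->] := reduced_extract rw ds => x y nxy.
by rewrite (extract_proj ds nxy) /proj /=.
Qed.

Lemma act_comm s t w : e s t -> trace_eq (act s (act t w)) (act t (act s w)).
Proof.
move=> est; have st := edge_neq est; have ets : e t s by rewrite e_sym.
have := extract_comm w est; rewrite /act.
case ds: (extract s w) => [ws|]; case dt: (extract t w) => [wt|] /=.
- by have := extract_extract st ds dt; case: (extract s wt) => //= w1 _ <-.
- by move=> /esym ->; rewrite eq_sym (negPf st) est ds.
- by move=> ->; rewrite (negPf st) ets dt.
- move=> _; rewrite eq_sym (negPf st) est ds /= ets dt /= => x y nxy.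
  rewrite /proj /=; have [sxy|_] := boolP (_ || _) => //.
  have [txy|_] := boolP (_ || _) => //.
  exfalso; case/orP: sxy => /eqP ?; case/orP: txy => /eqP ?; subst;
    by move: nxy st; rewrite ?eqxx ?est ?ets.
Qed.

(** * The action of W on reduced words *)

Local Notation run u z := (foldr act z u).

Lemma reduced_run u z : reduced z -> reduced (run u z).
Proof. by move=> rz; elim: u => //= s u; apply: reduced_act. Qed.

Lemma run_trace_eq u z z' : trace_eq z z' -> trace_eq (run u z) (run u z').
Proof. by move=> zz'; elim: u => //= s u; apply: act_trace_eq. Qed.

Lemma reduced_runE w : reduced w -> run w [::] = w.
Proof. by elim: w => //= s w IH /andP[/eqP ds /IH ->]; rewrite /act ds. Qed.

(** By [act_act] and [act_comm] the relations hold on reduced words up to exchanges. Generators act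
    as involutions, so [unzip1] may drop the exponents. *)
Lemma word_eq_run (u v : word V) : word_eq (racg_rel e) u v ->
  forall z, reduced z -> trace_eq (run (unzip1 u) z) (run (unzip1 v) z).
Proof.
elim=> [{}u|{}u {}v _ IH|{}u {}v w _ IHu _ IHv|{}u u' {}v v' _ IHu _ IHv|x b|
  {}u {}v R] z rz.
- by [].
- exact/trace_eq_sym/IH.
- exact: trace_eq_trans (IHu _ rz) (IHv _ rz).
- rewrite /unzip1 !map_cat !foldr_cat.
  apply: trace_eq_trans (run_trace_eq _ (IHv _ rz)).
  by apply: IHu; apply: reduced_run.
- exact: act_act.
- by case: R => [i|i j eij] /=; [apply: act_act | apply: act_comm].
Qed.

(** * Evaluation of words and the word problem *)

Definition ev w : racg e := \pi_(presented (racg_rel e))%qT (map (@letter V) w).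

Lemma unzip1_letter w : unzip1 (map (@letter V) w) = w.
Proof. by rewrite /unzip1 -map_comp map_id. Qed.

Lemma ev_cat u v : ev (u ++ v) = ev u * ev v.
Proof. by rewrite /ev map_cat -presented_mulE. Qed.

Lemma ev_nil : ev [::] = 1. Proof. by rewrite /ev. Qed.

Lemma ev_cons s w : ev (s :: w) = ev [:: s] * ev w.
Proof. exact: (ev_cat [:: s]). Qed.

Lemma ev_rcons w s : ev (rcons w s) = ev w * ev [:: s].
Proof. by rewrite -cats1 ev_cat. Qed.

Lemma ev_sq s : ev [:: s] * ev [:: s] = 1.
Proof. by rewrite -ev_cat -ev_nil /ev; apply/presented_eqP/word_eq_rel/racg_square. Qed.

Lemma ev_comm s t : e s t -> commute (ev [:: s]) (ev [:: t]).
Proof.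
move=> est; rewrite /commute -!ev_cat /ev.
exact/presented_eqP/word_eq_rel/racg_commute.
Qed.

Lemma ev_surj (x : racg e) : exists w, x = ev w.
Proof.
have [u ->] := presentedP x; exists (unzip1 u); rewrite /ev; apply/presented_eqP.
elim: u => [|[s b] u IH] /=; first exact: word_eq_refl.
apply: (@word_eq_cat _ _ [:: (s, b)] [:: letter s]) => //.
case: b; last exact: word_eq_refl.
apply: (@word_eq_trans _ _ [:: (s, true); (s, false); (s, false)]).
  apply: (@word_eq_cat _ _ [:: (s, true)] [:: (s, true)] [::]).
    exact: word_eq_refl.
  by apply/word_eq_sym/word_eq_rel/racg_square.
apply: (@word_eq_cat _ _ [:: (s, true); (s, false)] [::] [:: (s, false)]).
  exact: word_eq_cancel.
exact: word_eq_refl.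
Qed.

Lemma evV w : (ev w)^-1 = ev (rev w).
Proof.
apply: mulg1_eq; elim: w => [|s w IH]; first by rewrite ev_nil mulg1.
by rewrite rev_cons ev_rcons ev_cons -mulgA (mulgA (ev w)) IH mul1g ev_sq.
Qed.

Lemma evV1 s : (ev [:: s])^-1 = ev [:: s].
Proof. exact: evV. Qed.

(** A reduced word is recovered by letting it act on the empty word. *)
Lemma ev_inj u v : reduced u -> reduced v -> ev u = ev v -> trace_eq u v.
Proof.
move=> ru rv; rewrite /ev => /presented_eqP/word_eq_run/(_ [::] isT).
by rewrite !unzip1_letter !reduced_runE.
Qed.

Lemma ev_extract s w w' : extract s w = Some w' -> ev w = ev [:: s] * ev w'.
Proof.
elim: w w' => [|t w IH] //= w'; case: eqP => [-> [->]|_]; first exact: ev_cons.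
case: ifP => // est; case: (extract s w) IH => //= w1 /(_ _ erefl) E [<-].
by rewrite ev_cons E (ev_cons t w1) !mulgA (ev_comm est).
Qed.

Lemma shorten w : ~~ reduced w ->
  exists w', [/\ ev w' = ev w, size w' < size w & {subset w' <= w}].
Proof.
elim: w => [|s w IH] //=; case rw: (reduced w); last first.
  move=> _; have [w' [E sz sub]] := IH (negbT rw).
  exists (s :: w'); split=> //; first by rewrite (ev_cons s w') E -ev_cons.
  by move=> t; rewrite !inE; case: eqP => //= _ /sub.
case ds: (extract s w) => [w'|] // _; exists w'; split.
- by rewrite ev_cons (ev_extract ds) mulgA ev_sq mul1g.
- by rewrite ltnW // (extract_size ds).
- by move=> t tw'; rewrite inE (perm_mem (extract_perm ds)) inE tw' !orbT.
Qed.

Lemma reduced_form w :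
  exists w', [/\ reduced w', ev w' = ev w, size w' <= size w & {subset w' <= w}].
Proof.
have [n] := ubnP (size w); elim: n w => // n IH w; rewrite ltnS => szw.
have [rw|/shorten[w' [E sz sub]]] := boolP (reduced w); first by exists w; split.
have [w2 [r2 E2 sz2 sub2]] := IH w' (leq_trans sz szw).
exists w2; split=> //; first by rewrite E2.
  exact: leq_trans sz2 (ltnW sz).
by move=> t /sub2/sub.
Qed.

(** * Cliques, centralizers and involutions *)

(** The homomorphism from W to Z/2 that counts k, read off a chosen representative word. *)
Definition parity k (x : racg e) : bool := odd (count_mem k (unzip1 (repr x))).

Lemma word_eq_parity k (u v : word V) : word_eq (racg_rel e) u v ->
  odd (count_mem k (unzip1 u)) = odd (count_mem k (unzip1 v)).
Proof.
elim=> [{}u|{}u {}v _ //|{}u {}v w _ -> //|{}u u' {}v v' _ Eu _ Ev|s b|{}u {}v] //.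
- by rewrite /unzip1 !map_cat !count_cat !oddD Eu Ev.
- by rewrite /= addn0 oddD addbb.
- by case=> [i|i j _] /=; rewrite !addn0 ?oddD ?addbb // addbC.
Qed.

Lemma parity_ev k w : parity k (ev w) = odd (count_mem k w).
Proof.
by rewrite /parity /ev (word_eq_parity k (word_eq_repr _ _)) unzip1_letter.
Qed.

Lemma parityM k x y : parity k (x * y) = parity k x (+) parity k y.
Proof.
have [u ->] := ev_surj x; have [v ->] := ev_surj y.
by rewrite -ev_cat !parity_ev count_cat oddD.
Qed.

Lemma parity1 k : parity k 1 = false.
Proof. by rewrite -ev_nil parity_ev. Qed.

Lemma parityV k x : parity k x^-1 = parity k x.
Proof. by have [u ->] := ev_surj x; rewrite evV !parity_ev count_rev. Qed.

Lemma parityJ k x g : parity k (x ^ g) = parity k x.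
Proof. by rewrite !parityM parityV addbC -addbA addbb addbF. Qed.

Lemma star_sym i j : (i \in star e j) = (j \in star e i).
Proof. by rewrite !inE eq_sym e_sym. Qed.

Lemma star_refl i : i \in star e i.
Proof. by rewrite inE eqxx. Qed.

Lemma star_comm i j : i \in star e j -> commute (ev [:: i]) (ev [:: j]).
Proof. by rewrite inE => /orP[/eqP -> //|/ev_comm/commute_sym]. Qed.

Lemma commute_ev x w :
  {in w, forall s, commute x (ev [:: s])} -> commute x (ev w).
Proof.
elim: w => [|s w IH] xw; first by rewrite ev_nil; apply: commute1.
rewrite ev_cons; apply: commuteM; first by apply: xw; rewrite inE eqxx.
by apply: IH => t tw; apply: xw; rewrite inE tw orbT.
Qed.

(* x lies in the special subgroup W_T. *)
Definition special (T : {set V}) (x : racg e) :=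
  exists2 w, {subset w <= T} & x = ev w.

Definition clique (T : {set V}) := [forall s in T, forall t in T, s \in star e t].

Lemma cliqueP (T : {set V}) :
  reflect {in T &, forall s t, s \in star e t} (clique T).
Proof.
apply: (iffP forall_inP) => [cT s t sT tT|cT s sT].
  exact: (forall_inP (cT s sT)).
by apply/forall_inP => t tT; apply: cT.
Qed.

Definition common (C : seq V) : {set V} :=
  [set s | all (fun c => s \in star e c) C].

Lemma special1 T : special T 1. Proof. by exists [::]; rewrite // ev_nil. Qed.

Lemma special_gen (T : {set V}) s : s \in T -> special T (ev [:: s]).
Proof. by exists [:: s] => // t; rewrite inE => /eqP ->. Qed.

Lemma specialM T x y : special T x -> special T y -> special T (x * y).
Proof.
move=> [u uT ->] [v vT ->]; exists (u ++ v); rewrite ?ev_cat // => s.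
by rewrite mem_cat => /orP[/uT|/vT].
Qed.

Lemma specialV T x : special T x -> special T x^-1.
Proof.
by move=> [u uT ->]; exists (rev u); rewrite ?evV // => s; rewrite mem_rev => /uT.
Qed.

Lemma special_reduced T x : special T x ->
  exists w, [/\ reduced w, {subset w <= T} & x = ev w].
Proof.
move=> [u uT ->]; have [w [rw <- _ wu]] := reduced_form u.
by exists w; split=> // s /wu/uT.
Qed.

Lemma reduced_special (T : {set V}) w : reduced w -> special T (ev w) -> {subset w <= T}.
Proof.
move=> rw /special_reduced[u [ru uT E]] s sw; apply: uT.
by rewrite -(perm_mem (trace_eq_perm (ev_inj rw ru E))).
Qed.

Lemma parity_special (T : {set V}) k x : special T x -> parity k x -> k \in T.
Proof.
move=> [w wT ->]; rewrite parity_ev => ok; apply: wT.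
by rewrite -has_pred1 has_count; case: count ok.
Qed.

Lemma clique_seq_star C : pairwise e C -> {in C &, forall s t, s \in star e t}.
Proof.
elim: C => [|c C IH] //= /andP[/allP cC /IH cl] s t.
move=> /predU1P[->|sC] /predU1P[->|tC]; first exact: star_refl.
- by rewrite star_sym inE cC ?orbT.
- by rewrite inE cC ?orbT.
- exact: cl.
Qed.

Lemma clique_seq_reduced C : pairwise e C -> reduced C.
Proof.
elim: C => [|c C IH] //= /andP[/allP cC /IH ->]; rewrite andbT.
case dc: (extract c C) => [w|] //.
by have := cC c; rewrite (perm_mem (extract_perm dc)) inE eqxx e_irr => /(_ isT).
Qed.

Lemma clique_seq_uniq C : pairwise e C -> uniq C.
Proof.
elim: C => [|c C IH] //= /andP[/allP cC /IH ->]; rewrite andbT.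
by apply/negP => /cC; rewrite e_irr.
Qed.

Lemma parity_clique k C : pairwise e C -> parity k (ev C) = (k \in C).
Proof. by move=> /clique_seq_uniq uC; rewrite parity_ev count_uniq_mem // oddb. Qed.

Lemma extract_star s w : s \in w -> {in w, forall t, t \in star e s} -> extract s w != None.
Proof.
elim: w => [|t w IH] //= sw st; case: (eqVneq t s) => // ts.
have -> : e s t by have := st t (mem_head _ _); rewrite inE (negPf ts).
move: sw; rewrite inE eq_sym (negPf ts) /= => sw.
have := IH sw (fun r rw => st r (mem_behead (s := t :: w) rw)).
by case: (extract s w).
Qed.

Lemma reduced_clique_seq (T : {set V}) w :
  clique T -> {subset w <= T} -> reduced w -> pairwise e w.
Proof.
move=> /cliqueP cT; elim: w => [|s w IH] //= wT /andP[/eqP ds rw].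
have wT' : {subset w <= T} by move=> t tw; apply: wT; rewrite inE tw orbT.
have sT : s \in T by apply: wT; rewrite inE eqxx.
rewrite IH // andbT; apply/allP => t tw.
have := cT _ _ (wT' t tw) sT; rewrite inE => /orP[/eqP ts|//].
rewrite ts in tw; have : extract s w != None; last by rewrite ds.
by apply: extract_star tw _ => r /wT' rT; apply: cT.
Qed.

Lemma special_clique T x : clique T -> special T x ->
  exists C, [/\ pairwise e C, {subset C <= T} & x = ev C].
Proof.
move=> cT /special_reduced[w [rw wT ->]]; exists w; split=> //.
exact: reduced_clique_seq cT wT rw.
Qed.

(** For a clique T the group W_T is elementary abelian, with the parities as coordinates. *)
Lemma special_clique_parity_inj T x y : clique T -> special T x -> special T y ->
  (forall k, parity k x = parity k y) -> x = y.
Proof.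
move=> cT xT yT xy.
have [C [cC _ E]] := special_clique cT (specialM (specialV xT) yT).
suff C0 : C = [::] by rewrite -[x]invgK; apply: mulg1_eq; rewrite E C0 ev_nil.
case: C cC E => // c C cC E; have := parity_clique c cC.
by rewrite -E parityM parityV xy addbb inE eqxx.
Qed.

Lemma common_comm C x : special (common C) x -> commute (ev C) x.
Proof.
move=> [w wC ->]; apply: commute_ev => s /wC; rewrite inE => /allP sC.
by apply/commute_sym/commute_ev => c /sC/star_comm.
Qed.

Lemma extract_cat s u w : extract s u = None ->
  extract s (u ++ w) = if all (e s) u then omap (cat u) (extract s w) else None.
Proof.
elim: u => [|t u IH] /=; first by case: (extract s w).
case: eqP => // _; case: ifP => //= est; case: (extract s u) IH => // /(_ erefl) -> _.
by case: ifP => // _; case: (extract s w).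
Qed.

Lemma unreduced_cat u v : reduced u -> reduced v -> ~~ reduced (u ++ v) ->
  exists a s b v', [/\ u = a ++ s :: b, all (e s) b & extract s v = Some v'].
Proof.
elim: u => [|s u IH] /=; first by move=> _ ->.
move=> /andP[/eqP ds ru] rv; have [ruv|nuv _] := boolP (reduced (u ++ v)); last first.
  by have [a [t [b [v' [-> eb dv]]]]] := IH ru rv nuv; exists (s :: a), t, b, v'.
rewrite andbT extract_cat //; case: ifP => // su; case dv: (extract s v) => [v'|] // _.
by exists [::], s, u, v'.
Qed.

(** Induction on the length of w, stripping letters of the common star from its left. When no letter
    of C can be shuffled to the front of w, both [C ++ w] and [w ++ C] are reduced, hence differ by
    exchanges; this forces the first letter of w into the common star. *)
Lemma centralizer C x : pairwise e C -> commute (ev C) x -> special (common C) x.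
Proof.
move=> cC; have [w ->] := ev_surj x; have [n] := ubnP (size w).
elim: n w => // n IH w; rewrite ltnS => szw Cw.
have [rw|/shorten[w' [E sz _]]] := boolP (reduced w); last first.
  by rewrite -E; apply: IH; rewrite ?E // (leq_trans sz).
have strip s w' : s \in common C -> ev w = ev [:: s] * ev w' -> size w' < size w ->
    special (common C) (ev w).
  move=> sC E sz; rewrite E; apply: specialM; first exact: special_gen.
  apply: IH (leq_trans sz szw) _; have -> : ev w' = (ev [:: s])^-1 * ev w.
    by rewrite E mulKg.
  by apply: commuteM => //; apply/commuteV/common_comm/special_gen.
have [/hasP[c Cc dc]|/hasPn nd] := boolP (has (fun c => extract c w != None) C).
  case dw: (extract c w) dc => [w'|] // _; apply: (strip c w').
  - by rewrite inE; apply/allP => d dC; apply: (clique_seq_star cC).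
  - exact: ev_extract.
  - by rewrite (extract_size dw).
have rCw : reduced (C ++ w).
  apply/negPn/negP => /(unreduced_cat (clique_seq_reduced cC) rw).
  move=> [a [c [b [v [E _ dc]]]]]; have := nd c.
  by rewrite E mem_cat mem_head orbT dc => /(_ isT).
have rwC : reduced (w ++ C).
  have [//|/shorten[u [Eu szu _]]] := boolP (reduced (w ++ C)).
  have [v [rv Ev szv _]] := reduced_form u.
  have : trace_eq v (C ++ w) by apply: ev_inj; rewrite // Ev Eu !ev_cat.
  move=> /trace_eq_perm/perm_size svw; move: (leq_ltn_trans szv szu).
  by rewrite svw !size_cat addnC ltnn.
have tCw : trace_eq (C ++ w) (w ++ C) by apply: ev_inj; rewrite // !ev_cat.
case: w rw szw Cw strip nd rCw rwC tCw => [|s w] rw szw Cw strip nd rCw rwC tCw.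
  by rewrite ev_nil; apply: special1.
apply: (strip s w) => //; last exact: ev_cons.
have sC : s \notin C by apply/negP => /nd; rewrite /= eqxx.
rewrite inE; apply/allP => c cC'; rewrite inE.
have [//|sc] := eqVneq s c; apply/negPn/negP => /= nsc.
(* If s and c did not commute, the projections to this pair would start with a letter of C on one
   side and with s, which is not in C, on the other. *)
have := tCw s c; rewrite e_sym => /(_ nsc); rewrite /proj !filter_cat /= eqxx /=.
have [d C' dE] : exists2 d, d \in C & exists C', filter (pred2 s c) C = d :: C'.
  have : c \in filter (pred2 s c) C by rewrite mem_filter /= eqxx orbT.
  case dE: (filter _ _) => [|d C'] // _; exists d; last by exists C'.
  by have := mem_filter (pred2 s c) d C; rewrite dE inE eqxx => /esym/andP[].
by case: dE => C'' -> [ds _]; rewrite -ds C' in sC.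
Qed.

(** Since [w ++ w] is not reduced, some letter s can be shuffled to the end of w and also to its
    front. Keeping the letters of g and C inside w makes them inherit adjacency to s. *)
Lemma involution_clique w : ev w * ev w = 1 ->
  exists g C, [/\ {subset g <= w}, {subset C <= w}, pairwise e C
    & ev w = ev g * ev C * ev (rev g)].
Proof.
have [n] := ubnP (size w); elim: n w => // n IH w; rewrite ltnS => szw w2.
have [rw|/shorten[w' [E sz sub]]] := boolP (reduced w); last first.
  have [|g [C [gw Cw cC E']]] := IH w' (leq_trans sz szw); first by rewrite E.
  by exists g, C; split; rewrite -?E // => s; [move=> /gw/sub | move=> /Cw/sub].
have [->|w0] := eqVneq w [::]; first by exists [::], [::]; rewrite ev_nil !mulg1.
have : ~~ reduced (w ++ w).
  apply/negP => rww; move: w2; rewrite -ev_cat -ev_nil => /ev_inj-/(_ rww isT).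
  by move=> /trace_eq_perm/perm_size; rewrite size_cat; case: w w0 {szw rw rww}.
move=> /(unreduced_cat rw rw)[a [s [b [w' [E sb]]]]].
have Cb : commute (ev [:: s]) (ev b).
  by apply: commute_ev => t /(allP sb)/ev_comm.
have evw : ev w = ev a * ev [:: s] * ev b by rewrite E ev_cat ev_cons mulgA.
have abw : {subset a ++ b <= w}.
  by move=> t; rewrite E !mem_cat inE => /orP[] ->; rewrite ?orbT.
(* If these are two occurrences of s, w is the s-conjugate of a shorter involution; if they are one,
   s is adjacent to all other letters and joins the clique. *)
rewrite {1}E; case da: (extract s a) => [a'|]; last first.
  rewrite extract_cat //; case: ifP => // sa _.
  have Ca : commute (ev [:: s]) (ev a).
    by apply: commute_ev => t /(allP sa)/ev_comm.
  have Cab : commute (ev [:: s]) (ev (a ++ b)) by rewrite ev_cat; apply: commuteM.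
  have evw' : ev w = ev [:: s] * ev (a ++ b) by rewrite evw -Ca -mulgA ev_cat.
  have [||g [C [gab Cab' cC Eab]]] := IH (a ++ b).
  - by rewrite (leq_trans _ szw) // E !size_cat /= addnS.
  - by move: w2; rewrite evw' {1}Cab -mulgA (mulgA (ev [:: s])) ev_sq mul1g.
  have sab t : t \in a ++ b -> e s t.
    by rewrite mem_cat => /orP[/(allP sa)|/(allP sb)].
  exists g, (s :: C); split.
  - by move=> t /gab/abw.
  - move=> t; rewrite inE => /predU1P[->|/Cab'/abw //].
    by rewrite E mem_cat mem_head orbT.
  - by rewrite /= cC andbT; apply/allP => t /Cab'/sab.
  - rewrite evw' Eab (ev_cons s C) !mulgA; congr (_ * _ * _).
    by apply: commute_ev => t /gab/sab/ev_comm.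
move=> _; have aE := perm_mem (extract_perm da); have evab : ev w = ev (a' ++ b) ^ ev [:: s].
  rewrite evw (ev_extract da) conjgE evV1 ev_cat -!mulgA; congr (_ * (_ * _)).
  exact: Cb.
have [||g [C [gab Cab' cC Eab]]] := IH (a' ++ b).
- by rewrite (leq_trans _ szw) // E !size_cat /= addnS (extract_size da) addSn !ltnS leqnSn.
- by apply: (conjg_inj (ev [:: s])); rewrite conjMg -evab conj1g.
have sub t : t \in a' ++ b -> t \in w.
  move=> tab; apply: abw; move: tab; rewrite !mem_cat aE inE.
  by case/orP=> ->; rewrite ?orbT.
exists (s :: g), C; split=> //.
- move=> t; rewrite inE => /predU1P[->|/gab/sub //].
  by rewrite E mem_cat mem_head orbT.
- by move=> t /Cab'/sub.
- by rewrite evab Eab rev_cons ev_rcons (ev_cons s g) conjgE evV1 !mulgA.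
Qed.

Lemma conj_clique x : x * x = 1 -> exists g C, pairwise e C /\ x ^ g = ev C.
Proof.
have [w ->] := ev_surj x => /involution_clique[g [C [_ _ cC ->]]].
by exists (ev g), C; split=> //; rewrite -evV conjgE !mulgA mulVg mul1g mulgVK.
Qed.

Lemma special_sub (S T : {set V}) x : S \subset T -> special S x -> special T x.
Proof. by move=> /subsetP ST [w wS ->]; exists w => // t /wS/ST. Qed.

Lemma special_genE (T : {set V}) s : special T (ev [:: s]) -> s \in T.
Proof. by move=> /(@reduced_special _ [:: s] isT) -> //; rewrite inE. Qed.

Lemma special_commute (T : {set V}) x y : special T y ->
  {in T, forall s, commute x (ev [:: s])} -> commute x y.
Proof. by move=> [w wT ->] xT; apply: commute_ev => s /wT/xT. Qed.

Lemma gen_neq1 s : ev [:: s] <> 1.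
Proof. by move=> /(congr1 (parity s)); rewrite parity1 parity_ev /= eqxx. Qed.

Lemma commute_gen s x : commute (ev [:: s]) x <-> special (star e s) x.
Proof.
split=> [/(@centralizer [:: s] _ isT)|xs].
  by apply: special_sub; apply/subsetP => t; rewrite inE /= andbT.
by apply: special_commute xs _ => t; rewrite star_sym => /star_comm.
Qed.

(** * Automorphisms *)

Local Notation hom := {multiplicative racg e -> racg e}.
Implicit Types (phi psi : hom).

(** Parity of k after phi is a homomorphism to Z/2, hence the sum of the parities of the letters l
    for which phi(v_l) is odd in k. *)
Lemma parity_hom phi k x : parity k (phi x) ->
  exists2 l, parity l x & parity k (phi (ev [:: l])).
Proof.
have -> : parity k (phi x) =
    \big[addb/false]_(l | parity k (phi (ev [:: l]))) parity l x.
  have [w ->] := ev_surj x; elim: w => [|s w IH].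
    by rewrite ev_nil group_hom1 parity1 big1 // => l _; apply: parity1.
  rewrite ev_cons gmulfM parityM IH; under [RHS]eq_bigr do rewrite parityM.
  rewrite big_split /=; congr addb; rewrite big_mkcond (bigD1 s) //= big1.
    by rewrite parity_ev /= eqxx addbF; case: parity.
  by move=> l /negPf ls; rewrite parity_ev /= eq_sym ls; case: ifP.
move=> kx; apply: contrapT => nE; move: kx; rewrite big1 // => l kl.
by apply/negP => lx; apply: nE; exists l.
Qed.

Lemma special_hom (S T : {set V}) phi g x : special S x ->
  {in S, forall k, special T (phi (ev [:: k]) ^ g)} -> special T (phi x ^ g).
Proof.
move=> [w wS ->] ST; elim: w wS => [|s w IH] wS.
  by rewrite ev_nil group_hom1 conj1g; apply: special1.
rewrite ev_cons gmulfM conjMg; apply: specialM; first by apply/ST/wS/mem_head.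
by apply: IH => t tw; apply: wS; rewrite inE tw orbT.
Qed.

(** * The subgroups W_(Delta_i) under automorphisms *)

Lemma class_refl i : i \in star_class e i.
Proof. by rewrite inE. Qed.

Lemma mem_class i j : (j \in star_class e i) = (star e i == star e j).
Proof. by rewrite inE. Qed.

Lemma clique_class i : clique (star_class e i).
Proof.
apply/cliqueP => s t; rewrite !mem_class => /eqP si /eqP <-.
by rewrite si star_refl.
Qed.

Hypothesis star_incl : forall i j : V, star e i \subset star e j -> star e i = star e j.

(* The centre of the centralizer of v_i is W_(Delta_i); characterizing it so,
   without reference to generators, is what makes it follow automorphisms. *)
Lemma special_center i x : {in star e i, forall k, commute x (ev [:: k])} ->
  special (star_class e i) x.
Proof.
have [u ->] := ev_surj x; have [w [rw <- _ _]] := reduced_form u => wi.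
exists w => // s sw; rewrite mem_class; apply/eqP/star_incl/subsetP => k ki.
have /commute_sym/commute_gen/(reduced_special rw)/(_ _ sw) := wi k ki.
by rewrite star_sym.
Qed.

Lemma class_commute i y z : special (star_class e i) y -> y <> 1 ->
  commute y z -> special (star e i) z.
Proof.
move=> /(special_clique (clique_class i))[[|d D] [cD Di ->]].
  by rewrite ev_nil.
move=> _ /(centralizer cD); apply: special_sub; apply/subsetP => s.
have := Di d (mem_head _ _); rewrite mem_class => /eqP ->.
by rewrite inE => /allP/(_ d (mem_head _ _)).
Qed.

Lemma hom_transfer phi psi (phiK : cancel phi psi) (psiK : cancel psi phi)
    x y g :
  commute (phi x ^ g) y <-> commute x (psi (y ^ g^-1)).
Proof.
split=> [/(commuteJ g^-1)/(gmulf_commute psi)|/(gmulf_commute phi)/(commuteJ g)].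
  by rewrite conjgK phiK.
by rewrite psiK conjgKV.
Qed.

Lemma hom_class (phi psi : hom) (phiK : cancel phi psi) (psiK : cancel psi phi) i :
  exists j g, {in star_class e i, forall k, special (star_class e j) (phi (ev [:: k]) ^ g)}.
Proof.
have tr := hom_transfer phiK psiK.
have [|g [C [cC E]]] := @conj_clique (phi (ev [:: i])).
  by rewrite -gmulfM ev_sq group_hom1.
pose lift (c : V) := psi (ev [:: c] ^ g^-1).
have C_star c z : c \in C -> special (common C) z -> special (star e c) z.
  move=> cC'; apply: special_sub; apply/subsetP => s; rewrite inE.
  by move=> /allP/(_ c cC').
(* Up to conjugation by g, whatever commutes with v_i is sent into the centralizer of the product of
   C, so commutes with v_c; hence [lift c] is central in the centralizer of v_i. *)
have lift_class c : c \in C -> special (star_class e i) (lift c).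
  move=> Cc; apply: special_center => k /star_comm ik; apply/commute_sym/tr/commute_sym.
  apply/commute_gen/C_star => //; apply: centralizer => //; rewrite -E.
  by apply/commuteJ/gmulf_commute/commute_sym.
have lift1 c : lift c <> 1.
  rewrite -(group_hom1 psi) => /(can_inj psiK)/(congr1 (conjg^~ g)).
  by rewrite conjgKV conj1g; apply: gen_neq1.
(* [lift k] commutes with the nontrivial element [lift c] of W_(Delta_i), hence with v_i;
   transferred back, v_k centralizes the product of C. *)
have C_eq c k : c \in C -> k \in star e c -> k \in common C.
  move=> Cc kc; apply: special_genE; apply: centralizer => //; rewrite -E; apply/tr.
  apply/commute_gen/(class_commute (lift_class c Cc) (lift1 c)).
  by apply/gmulf_commute/commuteJ/star_comm; rewrite star_sym.
case: C => [|c C] in cC E C_star lift_class C_eq *.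
  exfalso; move: E; rewrite ev_nil => /eqP; rewrite conjg_eq1 => /eqP.
  by rewrite -(group_hom1 phi) => /(can_inj phiK)/gen_neq1.
(* For l in the star of c, [lift l] commutes with v_i, hence with v_k, which has the same star. *)
exists c, g => k ki; apply: special_center => l lc; apply/tr/commute_gen.
have := C_eq c l (mem_head _ _) lc => /special_gen/common_comm.
rewrite -E => /tr/commute_gen; apply: special_sub.
by move: ki; rewrite mem_class => /eqP ->.
Qed.

(* phi maps W_(Delta_i) into a conjugate of W_(Delta_(s i)). *)
Definition class_map phi (s : V -> V) := forall i, exists g,
  {in star_class e i, forall k, special (star_class e (s i)) (phi (ev [:: k]) ^ g)}.

Lemma class_map_exists (phi psi : hom) : cancel phi psi -> cancel psi phi ->
  exists s : V -> V, class_map phi s.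
Proof. by move=> phiK psiK; have /choice[s sP] := hom_class phiK psiK; exists s. Qed.

(** The conjugating elements for x and y may differ, but parities do not see this: a letter that is
    odd in phi(v_y) lies in the common star of the clique to which phi(v_x) is conjugate. *)
Lemma class_map_star phi (s : V -> V) x y : injective phi -> class_map phi s ->
  y \in star e x -> s y \in star e (s x).
Proof.
move=> phi_inj smap yx; have [g gx] := smap x; have [h hy] := smap y.
have nontriv i g' : phi (ev [:: i]) ^ g' <> 1.
  by move=> /eqP; rewrite conjg_eq1 -(group_hom1 phi) => /eqP/phi_inj/gen_neq1.
have [C [cC Cx E]] := special_clique (clique_class _) (gx x (class_refl x)).
have [D [cD Dy F]] := special_clique (clique_class _) (hy y (class_refl y)).
case: C => [|c C] in cC Cx E *; first by have := @nontriv x g; rewrite E ev_nil.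
case: D => [|d D] in cD Dy F *; first by have := @nontriv y h; rewrite F ev_nil.
have /eqP sx : star e (s x) == star e c by rewrite -mem_class Cx ?mem_head.
have /eqP sy : star e (s y) == star e d by rewrite -mem_class Dy ?mem_head.
have Cy : special (common (c :: C)) (phi (ev [:: y]) ^ g).
  apply: centralizer cC _; rewrite -E.
  by apply/commuteJ/gmulf_commute/commute_sym/star_comm.
have : d \in common (c :: C).
  by apply: (parity_special Cy); rewrite parityJ -(parityJ d _ h) F parity_clique // mem_head.
by rewrite inE sx star_sym sy star_sym => /andP[].
Qed.

(** The odd letter i of a conjugate of v_i is traced back through psi to a letter of Delta_(s i). *)
Lemma class_map_cancel phi psi (s t : V -> V) : cancel phi psi -> class_map phi s ->
  class_map psi t -> forall i, star e (t (s i)) = star e i.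
Proof.
move=> phiK smap tmap i; have [g gi] := smap i; have [h hi] := tmap (s i).
have gii := gi i (class_refl i).
have [] := @parity_hom psi i (phi (ev [:: i]) ^ g).
  by rewrite group_homJ phiK parityJ parity_ev /= eqxx.
move=> l /(parity_special gii) /hi li; rewrite -(parityJ i _ h) => /(parity_special li).
by rewrite mem_class => /eqP.
Qed.

(** W_(Delta_i) has 2^|Delta_i| elements and embeds in W_(Delta_(s i)); elements of the latter are
    encoded by their sets of odd letters. *)
Lemma class_map_card phi (s : V -> V) i : injective phi -> class_map phi s ->
  #|star_class e i| <= #|star_class e (s i)|.
Proof.
move=> phi_inj smap; have [g gi] := smap i.
pose f (A : {set V}) := [set k | parity k (phi (ev (enum A)))].
have fE (A : {set V}) : A \subset star_class e i ->
    special (star_class e (s i)) (phi (ev (enum A)) ^ g).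
  move=> /subsetP Ai; apply: (special_hom _ gi); exists (enum A) => // k.
  by rewrite mem_enum => /Ai.
rewrite -(@leq_exp2l 2) // -!card_powerset.
have f_inj : {in powerset (star_class e i) &, injective f}.
  move=> A B; rewrite !inE => As Bs /setP AB.
  have Ai := fE A As; have Bi := fE B Bs.
  have : ev (enum A) = ev (enum B).
    apply: phi_inj; apply: (conjg_inj g).
    apply: (special_clique_parity_inj (clique_class _) Ai Bi) => k.
    by have := AB k; rewrite !inE !parityJ.
  move=> EAB; apply/setP => k; move: (congr1 (parity k) EAB).
  by rewrite !parity_ev !count_uniq_mem ?enum_uniq // !mem_enum !oddb.
rewrite -(card_in_imset f_inj); apply: subset_leq_card.
apply/subsetP => B /imsetP[A As ->]; move: As; rewrite !inE => As.
apply/subsetP => k; rewrite [k \in f A]inE.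
by rewrite -(parityJ k _ g) => /(parity_special (fE A As)).
Qed.

Hypothesis automorphism_class : forall f : V -> V, graph_automorphism e f ->
  forall i, f @: star_class e i = star_class e i.

Lemma class_map_fixed phi psi (s : V -> V) : cancel phi psi -> cancel psi phi ->
  class_map phi s -> forall i, star e (s i) = star e i.
Proof.
move=> phiK psiK smap; have [t tmap] := class_map_exists psiK phiK.
have phi_inj := can_inj phiK; have psi_inj := can_inj psiK.
have tsK := class_map_cancel phiK smap tmap.
have stK := class_map_cancel psiK tmap smap.
have sE x k : (k \in star e (s x)) = (t k \in star e x).
  apply/idP/idP => [/(class_map_star psi_inj tmap)|/(class_map_star phi_inj smap) sk].
    by rewrite tsK.
  by rewrite star_sym -(stK k) star_sym.
have s_star x y : (star e (s x) == star e (s y)) = (star e x == star e y).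
  have starE z k : (k \in star e z) = (s k \in star e (s z)).
    by rewrite sE star_sym -(tsK k) star_sym.
  apply/idP/idP => /eqP xy; apply/eqP/setP => k; last by rewrite !sE xy.
  by rewrite (starE x) (starE y) xy.
pose cls i := enum (star_class e i).
have cls_star i j : star e i = star e j -> cls i = cls j.
  by move=> ij; apply: eq_enum => k; rewrite !mem_class ij.
have size_cls i : size (cls (s i)) = size (cls i).
  apply/eqP; rewrite -!cardE eqn_leq (class_map_card i phi_inj smap) andbT.
  have -> : star_class e i = star_class e (t (s i)).
    by apply/setP => k; rewrite !mem_class tsK.
  exact: class_map_card psi_inj tmap.
have idx i : index i (cls i) < size (cls (s i)).
  by rewrite size_cls index_mem mem_enum class_refl.
(* The graph automorphism to which (2) is applied matches Delta_i with Delta_(s i) position by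
   position; by [idx] the default of [nth] is never reached. *)
pose f i := nth i (cls (s i)) (index i (cls i)).
have f_star i : star e (f i) = star e (s i).
  have : f i \in cls (s i) by rewrite mem_nth.
  by rewrite mem_enum mem_class => /eqP.
have f_inj : injective f.
  move=> x y fxy; have /eqP := congr1 (star e) fxy; rewrite !f_star => sxy.
  have cls_s := cls_star _ _ (eqP sxy).
  have cls_xy : cls x = cls y by apply: cls_star; apply/eqP; rewrite -s_star.
  have idxy := idx y; move: fxy; rewrite /f (set_nth_default x y idxy) cls_s.
  move=> /eqP; rewrite nth_uniq ?enum_uniq -?cls_s ?idx //; last by rewrite cls_s.
  move=> /eqP ixy.
  have : nth x (cls x) (index x (cls x)) = nth x (cls y) (index y (cls y)).
    by rewrite ixy cls_xy.
  by rewrite !nth_index // mem_enum class_refl.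
have f_edge i j : e (f i) (f j) = e i j.
  have eE x y : e x y = (y != x) && (y \in star e x).
    by rewrite inE; case: eqP => // ->; rewrite e_irr.
  rewrite !eE (inj_eq f_inj) f_star star_sym f_star star_sym sE star_sym.
  by rewrite tsK star_sym.
have := automorphism_class (conj (injF_bij f_inj) f_edge) => cond i.
have : f i \in star_class e i by rewrite -cond imset_f // class_refl.
by rewrite mem_class f_star => /eqP.
Qed.

Lemma hom_fixes_class phi psi : cancel phi psi -> cancel psi phi ->
  forall i, exists g,
    {in star_class e i, forall k, special (star_class e i) (phi (ev [:: k]) ^ g)}.
Proof.
move=> phiK psiK i; have [s smap] := class_map_exists phiK psiK.
have [g gi] := smap i; exists g => k /gi; apply: special_sub.
by apply/subsetP => l; rewrite !mem_class (class_map_fixed phiK psiK smap).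
Qed.

(** * Automorphisms and a maximal clique *)

Variable M : {set V}.
Hypotheses (M_clique : clique M)
  (M_max : forall s, {in M, forall k, s \in star e k} -> s \in M).

Lemma common_M : common (enum M) = M.
Proof.
apply/setP => s; rewrite inE; apply/allP/idP => [sM|sM k].
  by apply: M_max => k kM; apply: sM; rewrite mem_enum.
by rewrite mem_enum => kM; move/cliqueP: M_clique; apply.
Qed.

Lemma class_subset_M i : i \in M -> star_class e i \subset M.
Proof.
move=> iM; apply/subsetP => k; rewrite mem_class => /eqP ik; apply: M_max => l lM.
by rewrite star_sym -ik star_sym; move/cliqueP: M_clique; apply.
Qed.

Lemma pairwise_M : pairwise e (enum M).
Proof.
have : {subset enum M <= M} by move=> k; rewrite mem_enum.
elim: (enum M) (enum_uniq M) => [|s C IH] //= /andP[sC uC] sM.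
have CM : {subset C <= M} by move=> t tC; apply: sM; rewrite inE tC orbT.
rewrite IH // andbT; apply/allP => t tC.
have : t \in star e s.
  by move/cliqueP: M_clique; apply; [apply: CM | apply: sM; apply: mem_head].
by rewrite inE => /predU1P[ts|//]; rewrite ts in tC; rewrite tC in sC.
Qed.

Lemma special_M_comm x y : special M x -> special M y -> commute x y.
Proof.
move=> xM yM; apply: (special_commute yM) => k kM; apply/commute_sym.
apply: (special_commute xM) => l lM; apply: star_comm.
by move/cliqueP: M_clique; apply.
Qed.

(** One g serves all k because it is chosen for the single involution phi of the product of M. The
    common star of C pulls back into the abelian group W_M, so it is itself a clique. *)
Lemma hom_fixes_max_clique phi psi : cancel phi psi -> cancel psi phi ->
  exists g, {in M, forall k, special (star_class e k) (phi (ev [:: k]) ^ g)}.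
Proof.
move=> phiK psiK; have tr := hom_transfer phiK psiK.
have evM : special M (ev (enum M)) by exists (enum M) => // k; rewrite mem_enum.
have [|g [C [cC E]]] := @conj_clique (phi (ev (enum M))).
  rewrite -gmulfM -(group_hom1 phi); congr (phi _).
  apply: (special_clique_parity_inj M_clique); [exact: specialM | exact: special1 |].
  by move=> k; rewrite parityM addbb parity1.
have liftM l : l \in common C -> special M (psi (ev [:: l] ^ g^-1)).
  move=> /special_gen/common_comm; rewrite -E => /tr/(centralizer pairwise_M).
  by rewrite common_M.
have clC : clique (common C).
  apply/cliqueP => s t sC tC; apply/special_genE/commute_gen.
  have /(gmulf_commute phi) := special_M_comm (liftM t tC) (liftM s sC).
  by rewrite !psiK => /(commuteJ g); rewrite !conjgKV.
exists g => k kM; have Ck : special (common C) (phi (ev [:: k]) ^ g).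
  apply: centralizer => //; rewrite -E; apply/commuteJ/gmulf_commute.
  by apply: special_M_comm => //; apply: special_gen.
have [D [cD _ F]] := special_clique clC Ck; exists D => // l lD.
(* This h depends on k, but parities are unchanged by conjugation, and every letter of the clique D
   is odd. *)
have [h hk] := hom_fixes_class phiK psiK k.
apply: (parity_special (hk k (class_refl k))).
by rewrite parityJ -(parityJ l _ g) F parity_clique.
Qed.

(** * The complement *)

Hypothesis star_proper : forall i : V, ~: star e i != set0.

(* By (1) the default i is never taken. *)
Definition far (i : V) : V := odflt i [pick k in ~: star e i].

Lemma far_notin i : far i \notin star e i.
Proof.
rewrite /far; case: pickP => [k|none] /=; first by rewrite inE.
by have /set0Pn[k] := star_proper i; have := none k; rewrite /= => ->.
Qed.

Lemma far_class i k : k \in star_class e i -> far k = far i.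
Proof.
rewrite mem_class => /eqP ik; rewrite /far ik.
case: pickP => [//|none]; have /set0Pn[l] := star_proper k.
by have := none l; rewrite /= => ->.
Qed.

(** * Conjugation in the extension *)

Variables (E G : groupType).
Variables (iota : {multiplicative racg e -> E}) (p : {multiplicative E -> G}).
Hypothesis ext : group_extension iota p.

Lemma conj_hom (x : E) : exists phi : hom, forall w : racg e, iota (phi w) = iota w ^ x.
Proof.
have [iota_inj exact _] := ext.
have /choice[f fE] : forall w : racg e, exists v : racg e, iota v = iota w ^ x.
  move=> w; apply/exact; rewrite group_homJ.
  by rewrite (proj2 (exact _) (ex_intro _ w erefl)) conj1g.
have fM : {morph f : u v / u * v}.
  by move=> u v; apply: iota_inj; rewrite fE !gmulfM conjMg !fE.
pose mix := isMultiplicative.Build (racg e) (racg e) f fM.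
pose phi : hom := HB.pack f mix.
by exists phi.
Qed.

Variable conj_by : E -> hom.
Hypothesis conjE : forall (x : E) (w : racg e), iota (conj_by x w) = iota w ^ x.

Lemma conj_mul x y (w : racg e) : conj_by (x * y) w = conj_by y (conj_by x w).
Proof. by apply: (extension_inj ext); rewrite !conjE conjgM. Qed.

Lemma conj_iota (g w : racg e) : conj_by (iota g) w = w ^ g.
Proof. by apply: (extension_inj ext); rewrite conjE group_homJ. Qed.

Lemma conj_1 (w : racg e) : conj_by 1 w = w.
Proof. by apply: (extension_inj ext); rewrite conjE conjg1. Qed.

Lemma conjK x : cancel (conj_by x) (conj_by x^-1).
Proof. by move=> w; rewrite -conj_mul mulgV conj_1. Qed.

Lemma conjVK x : cancel (conj_by x^-1) (conj_by x).
Proof. by move=> w; rewrite -conj_mul mulVg conj_1. Qed.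

(* The element g is determined by conj_by x up to the centralizer of v_(far i),
   which has no letter in Delta_i since far i is not in the star of i; so the
   parities of g on Delta_i are an invariant of x. *)
Definition complement (x : E) := {in M, forall i,
  special (star_class e i) (conj_by x (ev [:: i])) /\
  exists g, {in star_class e i, forall k, parity k g = false} /\
    {in star_class e (far i), forall k,
      special (star_class e (far i)) (conj_by x (ev [:: k]) ^ g)}}.

Lemma complementM x y : complement x -> complement y -> complement (x * y).
Proof.
move=> Hx Hy i iM; have [xi [g [gi gx]]] := Hx i iM; have [_ [h [hi hy]]] := Hy i iM.
split.
  rewrite conj_mul -[conj_by y _]conjg1; apply: special_hom xi _ => k ki; rewrite conjg1.
  have [yk _] := Hy k (subsetP (class_subset_M iM) k ki); apply: special_sub yk.
  move: ki; rewrite mem_class => /eqP ki.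
  by apply/subsetP => l; rewrite !mem_class ki.
exists (conj_by y g * h); split=> [k ki|k /gx]; last first.
  by move=> /special_hom/(_ hy); rewrite group_homJ -conjgM conj_mul.
(* An odd letter k of [conj_by y g] comes from an odd letter l of g; y preserves the classes up to
   conjugacy, so l lies in Delta_i, where g is even. *)
rewrite parityM hi // addbF; apply/negP => /parity_hom[l gl].
have [h' hl] := hom_fixes_class (conjK y) (conjVK y) l.
rewrite -(parityJ k _ h') => /(parity_special (hl l (class_refl l))) kl.
suff li : l \in star_class e i by rewrite gi in gl.
by move: ki kl; rewrite !mem_class => /eqP -> /eqP ->.
Qed.

Lemma complement_ker x : complement x -> p x = 1 -> x = 1.
Proof.
move=> Hx /(extension_exact ext)[g gx].
suff g1 : g = 1 by rewrite -gx g1 group_hom1.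
have conjx (w : racg e) : conj_by x w = w ^ g by rewrite -gx conj_iota.
(* Conjugation keeps parities, which determine an element of W_(Delta_i); so h centralizes v_i. *)
have fixed i h : special (star_class e i) (ev [:: i] ^ h) -> special (star e i) h.
  move=> ih; apply/commute_gen/commgP/conjg_fixP.
  apply: (special_clique_parity_inj (clique_class i) ih (special_gen (class_refl i))) => k.
  exact: parityJ.
have gM : special M g.
  rewrite -common_M; apply: centralizer pairwise_M _.
  apply/commute_sym/commute_ev => k; rewrite mem_enum => /Hx[].
  by rewrite conjx => /fixed/commute_gen/commute_sym.
apply: (special_clique_parity_inj M_clique gM (special1 _)) => i; rewrite parity1.
apply/negP => gi; have iM := parity_special gM gi; have [_ [h [hi hg]]] := Hx i iM.
have := hg _ (class_refl _); rewrite conjx -conjgM => /fixed/parity_special fi.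
(* [g * h] centralizes v_(far i), so its odd letter i would lie in the star of [far i]. *)
have /fi : parity i (g * h) by rewrite parityM gi hi // class_refl.
by rewrite star_sym (negPf (far_notin i)).
Qed.

Lemma complement_surj (u : G) : exists x, complement x /\ p x = u.
Proof.
have [x0 <-] := extension_surj ext u.
have p_iota g : p (iota g) = 1 by apply/(extension_exact ext); exists g.
have [g0 g0M] := hom_fixes_max_clique (conjK x0) (conjVK x0).
set x1 := x0 * iota g0.
have x1M : {in M, forall k, special (star_class e k) (conj_by x1 (ev [:: k]))}.
  by move=> k /g0M; rewrite conj_mul conj_iota.
have /choice[g gP] := hom_fixes_class (conjK x1) (conjVK x1).
(* The element of W_M whose parities on M make [a^-1 * g (far k)] even in k. Since W_M is abelian,
   this correction keeps the first condition. *)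
pose a := ev [seq k <- enum M | parity k (g (far k))].
have aM : special M a.
  exists [seq k <- enum M | parity k (g (far k))] => // k.
  by rewrite mem_filter mem_enum => /andP[].
exists (x1 * iota a); split; last by rewrite !gmulfM !p_iota !mulg1.
move=> i iM; split.
  rewrite conj_mul conj_iota; have xi := x1M i iM.
  suff /conjg_fixP -> : [~ conj_by x1 (ev [:: i]), a] == 1 by [].
  apply/commgP; apply: special_M_comm => //.
  exact: special_sub (class_subset_M iM) xi.
exists (a^-1 * g (far i)); split=> k ki; last first.
  by rewrite conj_mul conj_iota conjgM conjgK; apply: gP.
(* All k in Delta_i share the far vertex of i, so one correction works for the whole class. *)
have -> : parity k (a^-1 * g (far i)) = parity k a (+) parity k (g (far k)).
  by rewrite parityM parityV (far_class ki).
rewrite parity_ev count_uniq_mem; last exact: filter_uniq (enum_uniq _).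
rewrite mem_filter mem_enum.
by rewrite (subsetP (class_subset_M iM) k ki) andbT oddb addbb.
Qed.

Lemma complement_split : split_extension p.
Proof.
have inj x y : complement x -> complement y -> p x = p y -> x = y.
  (* A member z of the complement over [(p x)^-1] is a left inverse of both x and y. *)
  move=> Hx Hy pxy; have [z [Hz pz]] := complement_surj (p x)^-1.
  have zP (v : E) : complement v -> p v = p x -> z * v = 1.
    move=> Hv pv; apply: complement_ker; first exact: complementM.
    by rewrite gmulfM pz pv mulVg.
  by apply: (mulgI z); rewrite !zP.
have /choice[s sP] := complement_surj.
have sM : {morph s : u v / u * v}.
  move=> u v; have [Hu pu] := sP u; have [Hv pv] := sP v; have [Huv puv] := sP (u * v).
  by apply: inj => //; [apply: complementM | rewrite gmulfM pu pv puv].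
pose mix := isMultiplicative.Build G E s sM.
pose section : {multiplicative G -> E} := HB.pack s mix.
by exists section => u; have [_] := sP u.
Qed.

End RightAngledCoxeter.

Theorem corollary8p10 (N : nat) (e : rel 'I_N) (N_ge1 : 1 <= N)
    (e_irr : irreflexive e) (e_sym : symmetric e)
    (cond1 : forall i : 'I_N, ~: star e i != set0)
    (cond2 : forall f : 'I_N -> 'I_N, graph_automorphism e f ->
               forall i : 'I_N, f @: star_class e i = star_class e i)
    (cond3 : forall i j : 'I_N, star e i \subset star e j <-> star e i = star e j)
    (E G : groupType)
    (iota : {multiplicative racg e -> E}) (p : {multiplicative E -> G})
    (ext : group_extension iota p) :
  split_extension p.
Proof.
have clique0 : clique e set0 by apply/cliqueP => s t; rewrite inE.
have [M /maxsetP[M_clique M_max] _] := maxset_exists clique0.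
have M_max' s : {in M, forall k, s \in star e k} -> s \in M.
  move=> sM; suff <- : s |: M = M by rewrite setU11.
  apply: M_max (subsetUr _ _); apply/cliqueP => x y.
  rewrite !in_setU1 => /predU1P[->|xM] /predU1P[->|yM].
  - exact: star_refl.
  - exact: sM.
  - by rewrite (star_sym e_sym) sM.
  - by move/cliqueP: M_clique; apply.
have /choice[conj conjE] := conj_hom ext.
apply: (complement_split e_irr e_sym _ cond2 M_clique M_max' cond1 ext conjE).
by move=> i j /cond3.
Qed.
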